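(* Let $\omega=(i_1\ldots i_s)$ be a word in $\Omega$. Then $$\operatorname{codim}\mathcal{E}_\omega\ \ge\ -\sum_{i\in I}\frac{|\omega|_i(|\omega|_i-1)}{2}+\sum_{1\le k<l\le s}\#\{\text{arrows from } i_l\text{ to } i_k\}.$$
   Context: The ground field $K$ is algebraically closed of characteristic $0$, and $Q$ is a finite quiver without oriented cycles with vertex set $I$. $\mathbf{N}I$ is the set of vectors with nonnegative integer coordinates in the free abelian group on symbols $\sigma_i$ ($i\in I$). For $d\in\mathbf{N}I$, $R_d=\bigoplus_{\alpha:i\to j}\mathrm{Hom}_K(K^{d_i},K^{d_j})$ is the affine variety of representations of $Q$ of dimension vector $d$. For $\mathcal{A}\subset R_d$, $\mathcal{B}\subset R_e$, the set $\mathcal{A}*\mathcal{B}\subset R_{d+e}$ consists of all $X\in R_{d+e}$ for which there is an exact sequence of representations $0\to N\to X\to M\to 0$ with $M\in\mathcal{A}$, $N\in\mathcal{B}$; this operation is associative. $\Omega$ is the set of finite words in the alphabet $I$; for $\omega=(i_1\ldots i_s)$ we put $|\omega|=\sigma_{i_1}+\cdots+\sigma_{i_s}\in\mathbf{N}I$, so that $|\omega|_i$ is the number of occurrences of the letter $i$ in $\omega$, and $\mathcal{E}_\omega:=R_{\sigma_{i_1}}*\cdots*R_{\sigma_{i_s}}$, an irreducible closed subvariety of $R_{|\omega|}$. Finally $\operatorname{codim}\mathcal{E}_\omega:=\dim R_{|\omega|}-\dim\mathcal{E}_\omega$. *)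

(* Defs.v *)
From mathcomp Require Import all_boot all_order all_algebra.
From mathcomp Require Import boolp classical_sets.
From mathcomp Require mpoly.

Set Implicit Arguments.
Unset Strict Implicit.
Unset Printing Implicit Defensive.

Import GRing.Theory.
Local Open Scope classical_set_scope.
Local Open Scope ring_scope.

Record quiver (I : finType) := Quiver {
  arrow : finType;
  src : arrow -> I;
  tgt : arrow -> I }.

Definition adjacent (I : finType) (Q : quiver I) : rel I :=
  fun i j => [exists a : arrow Q, (src a == i) && (tgt a == j)].

(* In path.v, cycle e [:: x] means e x x, so loops are excluded too. *)
Definition acyclic (I : finType) (Q : quiver I) : Prop :=
  forall c : seq I, cycle (adjacent Q) c -> c = [::].

Definition dimvec (I : finType) := I -> nat.

Definition dvzero (I : finType) : dimvec I := fun _ => 0%N.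

Definition dvadd (I : finType) (d e : dimvec I) : dimvec I :=
  fun i => (d i + e i)%N.

Definition sigma (I : finType) (i : I) : dimvec I := fun j => (i == j : nat).

Definition weight (I : finType) (w : seq I) : dimvec I :=
  foldr (fun i => dvadd (sigma i)) (@dvzero I) w.

(* As in mxalgebra, the vectors of K^m are row vectors, and a linear map
   K^m -> K^n is an m x n matrix acting by multiplication on the right. *)
Definition rep (K : fieldType) (I : finType) (Q : quiver I) (d : dimvec I) :=
  forall a : arrow Q, 'M[K]_(d (src a), d (tgt a)).

Section Extensions.
Variables (K : fieldType) (I : finType) (Q : quiver I).

Definition rep_hom (d e : dimvec I) (X : rep K Q d) (Y : rep K Q e)
    (f : forall i, 'M[K]_(d i, e i)) : Prop :=
  forall a : arrow Q, X a *m f (tgt a) = f (src a) *m Y a.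

(* row_free means injective and row_full means surjective for the action on
   row vectors. *)
Definition short_exact (d e x : dimvec I)
    (N : rep K Q e) (X : rep K Q x) (M : rep K Q d) : Prop :=
  exists (f : forall i, 'M[K]_(e i, x i)) (g : forall i, 'M[K]_(x i, d i)),
  [/\ rep_hom N X f, rep_hom X M g &
      forall i, [/\ row_free (f i), row_full (g i) &
                    (f i == kermx (g i))%MS]].

Definition ext_prod (d e : dimvec I)
    (A : set (rep K Q d)) (B : set (rep K Q e)) : set (rep K Q (dvadd d e)) :=
  [set X | exists M N, [/\ A M, B N & short_exact N X M]].

(* The empty product is the one-point space of representations of dimension
   vector 0, which is the unit of ext_prod. *)
Fixpoint word_variety (w : seq I) : set (rep K Q (weight w)) :=
  match w with
  | [::] => setT
  | i :: w' => ext_prod (setT : set (rep K Q (sigma i))) (@word_variety w')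
  end.

End Extensions.

Arguments word_variety K {I} Q w.

Section Zariski.
Variables (K : fieldType) (I : finType) (Q : quiver I) (d : dimvec I).

(* The index set of the matrix entries, i.e. of the coordinates of the affine
   space of representations of dimension vector d. *)
Definition rep_coord : finType :=
  {a : arrow Q & ('I_(d (src a)) * 'I_(d (tgt a)))%type}.

Definition coords (X : rep K Q d) : 'I_#|rep_coord| -> K :=
  fun k => let c := enum_val k in X (tag c) (tagged c).1 (tagged c).2.

Definition zariski_closed (Z : set (rep K Q d)) : Prop :=
  exists S : set (mpoly.mpoly #|rep_coord| K),
    Z = [set X | forall p, S p -> mpoly.meval (coords X) p = 0].

Definition closed_in (A Z : set (rep K Q d)) : Prop :=
  exists2 F, zariski_closed F & Z = A `&` F.

(* Irreducibility of Z in the topology induced by the Zariski topology. *)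
Definition irreducible (Z : set (rep K Q d)) : Prop :=
  Z !=set0 /\
  forall F G, zariski_closed F -> zariski_closed G ->
    Z `<=` F `|` G -> Z `<=` F \/ Z `<=` G.

Definition irr_chain (A : set (rep K Q d)) (n : nat) : Prop :=
  exists Z : nat -> set (rep K Q d),
    (forall k, (k <= n)%N -> closed_in A (Z k) /\ irreducible (Z k)) /\
    (forall k, (k < n)%N -> Z k `<` Z k.+1).

(* Krull dimension of A for the induced topology, i.e. the largest length of a
   chain of irreducible closed subsets of A; the default value 0 is only used
   when A is empty. *)
Definition krull_dim (A : set (rep K Q d)) : nat :=
  xget 0%N [set n | irr_chain A n /\ forall m, irr_chain A m -> (m <= n)%N].

Definition codim (A : set (rep K Q d)) : int :=
  (krull_dim setT)%:Z - (krull_dim A)%:Z.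

End Zariski.

Definition arrows_from_to (I : finType) (Q : quiver I) (i j : I) : nat :=
  #|[pred a : arrow Q | (src a == i) && (tgt a == j)]|.

(* Main.v *)
Require Import Defs.
From mathcomp Require Import all_boot all_order all_algebra.
From mathcomp Require Import fingroup perm.
From mathcomp Require Import boolp classical_sets.
From mathcomp Require Import zify.
From mathcomp Require Import (canonicals) mpoly.

(** The word variety is covered by finitely many polynomial images of an affine
    space, and an image of K^m has dimension at most m.

    Parametrization (word_variety_param).  A representation in E_w carries a
    filtration with one-dimensional quotients at the vertices i_1, ..., i_s,
    the last letter being the bottom step.  Choosing the filtration means
    choosing a full flag at each vertex i, and flags are covered by finitely
    many charts, each an affine space of dimension d_i (d_i - 1) / 2.  Once the
    flags are in standard position, the representation is given by matrix
    entries, and an entry going from the l-th to the k-th letter must vanish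
    when k < l: this kills one entry for each arrow from i_l to i_k.  Hence
      m = sum_i d_i (d_i - 1) / 2 + dim R_d - #{arrows i_l -> i_k, k < l},
    and dim R_d - m is the asserted bound.  Flags are not used explicitly: the
    first letter is split off, a hyperplane is chosen at that vertex, and the
    rest follows by induction (short_exact_glue, row_full_shear).

    Dimension bound (irr_chain_le_parameters).  Transcendence degrees are
    replaced by counting functions of bounded degree.  If Z < Z' are
    irreducible, f vanishes on Z but not on Z', and the u_j are linearly
    independent on Z, then the products u_j f^k are linearly independent on Z'
    (lin_indep_on_powers).  So a chain of length n yields, for all D, a family
    of D^n independent functions whose degrees are O(D) (chain_lin_indep).
    Pulled back to K^m these functions lie in spaces of dimension O(D^m), and
    if m < n some combination vanishes on all the images.

    Ambient dimension (krull_dim_setT).  The codimension also involves the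
    dimension of R_d: the identity of affine space is a parametrization, which
    bounds chains from above, and the coordinate subspaces form a chain that
    attains the bound. *)

Set Implicit Arguments.
Unset Strict Implicit.
Unset Printing Implicit Defensive.

Import Order.TTheory GRing.Theory Num.Theory.
Local Open Scope ring_scope.

(** * Polynomial functions *)

Section PolynomialFunctions.
Variable K : fieldType.

(** Polynomials of degree at most m in the coordinates x, as functions on T.
    They are generated inductively because only composition, restriction to
    curves and the dimension of their span are ever needed, and each follows
    by induction on the generation. *)
Inductive polyfun (T C : Type) (x : C -> T -> K) : nat -> (T -> K) -> Prop :=
| polyfun_const (a : K) : polyfun x 0 (fun=> a)
| polyfun_coord (c : C) : polyfun x 1 (x c)
| polyfun_add (m : nat) (f g : T -> K) :
    polyfun x m f -> polyfun x m g -> polyfun x m (fun t => f t + g t)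
| polyfun_mul (m n : nat) (f g : T -> K) :
    polyfun x m f -> polyfun x n g -> polyfun x (m + n) (fun t => f t * g t)
| polyfun_le (m n : nat) (f : T -> K) :
    (m <= n)%N -> polyfun x m f -> polyfun x n f.

Section Closure.
Variables (T C : Type) (x : C -> T -> K).

Lemma polyfun_ext m (f g : T -> K) : f =1 g -> polyfun x m f -> polyfun x m g.
Proof. by move=> /funext ->. Qed.

Lemma polyfun_sum (J : Type) (r : seq J) (P : pred J) m (F : J -> T -> K) :
  (forall j, polyfun x m (F j)) ->
  polyfun x m (fun t => \sum_(j <- r | P j) F j t).
Proof.
move=> pF; elim: r => [|j r IHr].
  by apply: polyfun_ext (polyfun_le (leq0n m) (polyfun_const x 0)) => t;
    rewrite big_nil.
case Pj: (P j).
  by apply: polyfun_ext (polyfun_add (pF j) IHr) => t; rewrite big_cons Pj.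
by apply: polyfun_ext IHr => t; rewrite big_cons Pj.
Qed.

Lemma polyfun_exp m (f : T -> K) k :
  polyfun x m f -> polyfun x (m * k) (fun t => f t ^+ k).
Proof.
move=> pf; elim: k => [|k IHk].
  by rewrite muln0; apply: polyfun_ext (polyfun_const x 1) => t; rewrite expr0.
by rewrite mulnS; apply: polyfun_ext (polyfun_mul pf IHk) => t; rewrite exprS.
Qed.

Lemma polyfun_scale m (a : K) (f : T -> K) :
  polyfun x m f -> polyfun x m (fun t => a * f t).
Proof. by move=> pf; apply: (polyfun_mul (polyfun_const x a) pf). Qed.

End Closure.

Lemma polyfun_comp (T S C B : Type) (x : C -> T -> K) (y : B -> S -> K) m n
    (phi : S -> T) (f : T -> K) :
  (forall c, polyfun y n (fun s => x c (phi s))) ->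
  polyfun x m f -> polyfun y (m * n) (fun s => f (phi s)).
Proof.
move=> pphi; elim=> {m f} [a|c|m f g _ pf _ pg|m m' f g _ pf _ pg|m m' f mm' _ pf].
- exact: polyfun_const.
- by rewrite mul1n.
- exact: polyfun_add.
- by rewrite mulnDl; apply: polyfun_mul.
- by apply: polyfun_le pf; rewrite leq_mul2r mm' orbT.
Qed.

(** Along a curve with polynomial coordinates a polynomial function becomes a
    univariate polynomial, whose roots can be counted. *)
Lemma polyfun_line (T C : Type) (x : C -> T -> K) m (f : T -> K) (l : K -> T) :
  (forall c, exists p : {poly K}, forall t, x c (l t) = p.[t]) ->
  polyfun x m f -> exists p : {poly K}, forall t, f (l t) = p.[t].
Proof.
move=> pl; elim=> {m f}
  [a|c|m f g _ [p fp] _ [q gq]|m n f g _ [p fp] _ [q gq]|m n f _ _ //].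
- by exists a%:P => t; rewrite hornerC.
- exact: pl.
- by exists (p + q) => t; rewrite hornerD fp gq.
- by exists (p * q) => t; rewrite hornerM fp gq.
Qed.

Lemma meval_polyfun (T : Type) n (x : T -> 'I_n -> K) (p : mpoly.mpoly n K) :
  exists m, polyfun (fun c t => x t c) m (fun t => mpoly.meval (x t) p).
Proof.
rewrite (funext (fun t => mpoly.mevalE (x t) p)).
elim: (mpoly.msupp p) => [|e r [m IHr]].
  exists 0%N; apply: polyfun_ext (polyfun_const _ 0) => t.
  by rewrite big_nil.
have [m' pe] : exists m', polyfun (fun c t => x t c) m'
    (fun t => \prod_i x t i ^+ mpoly.fun_of_multinom e i).
  elim: (index_enum _) => [|i s [m' IHs]].
    by exists 0%N; apply: polyfun_ext (polyfun_const _ 1) => t; rewrite big_nil.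
  exists (1 * mpoly.fun_of_multinom e i + m')%N.
  apply: polyfun_ext
    (polyfun_mul (polyfun_exp _ (polyfun_coord _ i)) IHs) => t.
  by rewrite big_cons.
exists (maxn m' m); apply: polyfun_ext (polyfun_add
  (polyfun_le (leq_maxl m' m) (polyfun_scale (mpoly.mcoeff e p) pe))
  (polyfun_le (leq_maxr m' m) IHr)) => t.
by rewrite big_cons.
Qed.

Lemma polyfun_meval (T : Type) n (x : T -> 'I_n -> K) m (f : T -> K) :
  polyfun (fun c t => x t c) m f ->
  exists p : mpoly.mpoly n K, forall t, mpoly.meval (x t) p = f t.
Proof.
elim=> {m f} [a|c|m f g _ [p fp] _ [q gq]|m k f g _ [p fp] _ [q gq]|m k f _ _ //].
- by exists (mpoly.mpolyC n a) => t; rewrite mpoly.mevalC.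
- by exists (mpoly.mpolyX K (mpoly.mnm1 c)) => t; rewrite mpoly.mevalXU.
- by exists (p + q) => t; rewrite mpoly.mevalD fp gq.
- by exists (p * q) => t; rewrite mpoly.mevalM fp gq.
Qed.

(** The point of recording degrees: functions of degree at most m in the
    coordinates x lie in a space of dimension at most (m + 1) ^ #|C|, which is
    bounded by a polynomial of degree #|C| in m. *)
Section MonomialSpan.
Variables (T : Type) (C : finType) (x : C -> T -> K).

Definition monomial m (e : {ffun C -> 'I_m.+1}) (t : T) : K :=
  \prod_c x c t ^+ e c.

Definition in_monomial_span m (f : T -> K) : Prop :=
  exists a : {ffun C -> 'I_m.+1} -> K,
    forall t, f t = \sum_e a e * monomial e t.

Lemma in_monomial_span_prod m (e : C -> nat) :
  (forall c, e c <= m)%N ->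
  in_monomial_span m (fun t => \prod_c x c t ^+ e c).
Proof.
move=> em; pose e' := [ffun c => inord (e c) : 'I_m.+1].
exists (fun e1 => (e1 == e')%:R) => t.
rewrite (bigD1 e') //= eqxx mul1r [X in _ + X]big1 ?addr0; last first.
  by move=> e1 /negPf ->; rewrite mul0r.
by apply: eq_bigr => c _; rewrite ffunE inordK // ltnS.
Qed.

Lemma in_monomial_span_sum m (J : finType) (b : J -> K) (F : J -> T -> K) :
  (forall j, in_monomial_span m (F j)) ->
  in_monomial_span m (fun t => \sum_j b j * F j t).
Proof.
move=> /choice [a Fa]; exists (fun e => \sum_j b j * a j e) => t.
under [RHS]eq_bigr do rewrite mulr_suml.
rewrite exchange_big /=; apply: eq_bigr => j _.
by rewrite Fa mulr_sumr; apply: eq_bigr => e _; rewrite mulrA.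
Qed.

Lemma polyfun_in_monomial_span m (f : T -> K) :
  polyfun x m f -> in_monomial_span m f.
Proof.
elim=> {m f} [a|c|m f g _ [a fa] _ [b gb]|m n f g _ [a fa] _ [b gb]
             |m n f mn _ [a fa]].
- exists (fun=> a) => t; rewrite (bigD1 [ffun=> ord0]) //= /monomial.
  rewrite [X in _ * X + _]big1 => [|c _]; last by rewrite ffunE expr0.
  rewrite mulr1 big1 ?addr0 // => e /eqP[]; apply/ffunP => c.
  by rewrite ffunE ord1.
- have [a fa] := @in_monomial_span_prod 1 (fun c' => c' == c)
    (fun c' => leq_b1 (c' == c)).
  exists a => t; rewrite -fa (bigD1 c) //= eqxx expr1 [X in _ * X]big1 ?mulr1 //.
  by move=> c' /negPf ->; rewrite expr0.
- exists (fun e => a e + b e) => t; rewrite fa gb -big_split /=.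
  by apply: eq_bigr => e _; rewrite mulrDl.
- have [d hd] : in_monomial_span (m + n)
      (fun t => \sum_e \sum_e' (a e * b e') *
        (monomial e t * monomial e' t)).
    have -> : (fun t => \sum_e \sum_e' (a e * b e') *
        (monomial e t * monomial e' t)) =
      (fun t => \sum_(j : {ffun C -> 'I_m.+1} * {ffun C -> 'I_n.+1})
        (a j.1 * b j.2) * (monomial j.1 t * monomial j.2 t)).
      by apply: funext => t; rewrite pair_bigA.
    apply: in_monomial_span_sum => -[e e'] /=.
    have [d hd] := @in_monomial_span_prod (m + n) (fun c => e c + e' c)%N
      (fun c => leq_add (leq_ord (e c)) (leq_ord (e' c))).
    exists d => t; rewrite -hd /monomial -big_split /=.
    by apply: eq_bigr => c _; rewrite exprD.
  exists d => t; rewrite -hd fa gb mulr_suml.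
  apply: eq_bigr => e _; rewrite mulr_sumr; apply: eq_bigr => e' _.
  by rewrite mulrACA.
- have [d hd] : in_monomial_span n (fun t => \sum_e a e * monomial e t).
    apply: in_monomial_span_sum => e.
    apply: in_monomial_span_prod => c.
    by apply: leq_trans mn; rewrite -ltnS.
  by exists d => t; rewrite -hd.
Qed.

End MonomialSpan.

End PolynomialFunctions.

(** * Lengths of chains of irreducible sets *)

Section LinearDependence.
Variable K : fieldType.

Lemma exists_dependence (J B : finType) (a : J -> B -> K) :
  (#|B| < #|J|)%N ->
  exists2 v : J -> K, exists j, v j != 0 &
    forall b, \sum_j v j * a j b = 0.
Proof.
move=> ltBJ.
pose M : 'M[K]_(#|J|, #|B|) := \matrix_(j, b) a (enum_val j) (enum_val b).
have : kermx M != 0.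
  by rewrite kermx_eq0 -row_leq_rank -ltnNge (leq_ltn_trans (rank_leq_col M)).
case/rowV0Pn => v /sub_kermxP vM vn0.
have [j vj] : exists j, v 0 j != 0.
  apply/existsP; apply: contra_neqT vn0 => /existsPn v0.
  by apply/rowP => j; rewrite mxE; apply/eqP; rewrite -[_ == _]negbK v0.
exists (fun j => v 0 (enum_rank j)); first by exists (enum_val j); rewrite enum_valK.
move=> b; have /rowP/(_ (enum_rank b)) := vM; rewrite !mxE => vMb.
rewrite -[RHS]vMb (reindex _ (onW_bij _ (enum_val_bij J))) /=; apply: eq_bigr => k _.
by rewrite enum_valK mxE enum_rankK.
Qed.

End LinearDependence.

Lemma exists_expn_gt (m n G b : nat) :
  (m < n)%N -> exists D, (b * (G * D).+1 ^ m < D ^ n)%N.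
Proof.
(* As G D + 1 <= (G + 1) D, the left-hand side is at most (D - 1) D ^ m. *)
move=> mn; pose D := (b * G.+1 ^ m).+1; exists D.
have Dgt0 : (0 < D)%N by [].
apply: (@leq_ltn_trans (b * (G.+1 * D) ^ m)).
  rewrite leq_mul2l; apply/orP; right.
  by case: (m) => // m'; rewrite leq_exp2r // mulSn -add1n leq_add2r.
apply: (@leq_trans (D ^ m.+1)); last by rewrite leq_pexp2l.
by rewrite expnMn mulnA expnS ltn_pmul2r ?expn_gt0.
Qed.

Section Chains.
Local Open Scope classical_set_scope.
Variables (K : fieldType) (I : finType) (Q : quiver I) (d : dimvec I).
Local Notation rp := (rep K Q d).
Local Notation regular := (polyfun (fun c (X : rp) => coords X c)).

Lemma zariski_closed_zeros m (f : rp -> K) :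
  regular m f -> zariski_closed [set X | f X = 0].
Proof.
case/polyfun_meval=> p fp; exists [set p]; apply/seteqP; split=> X /=.
  by move=> fX q ->; rewrite fp.
by move=> /(_ p erefl); rewrite fp.
Qed.

Lemma irreducible_mul_eq0 (Z : set rp) m n (f g : rp -> K) :
  irreducible Z -> regular m f -> regular n g ->
  (forall X, Z X -> f X * g X = 0) ->
  (forall X, Z X -> f X = 0) \/ (forall X, Z X -> g X = 0).
Proof.
move=> [_ irrZ] pf pg fg0.
apply: (irrZ _ _ (zariski_closed_zeros pf) (zariski_closed_zeros pg)) => X ZX.
by have /eqP := fg0 X ZX; rewrite mulf_eq0 => /orP[] /eqP ?; [left | right].
Qed.

(** Closedness of Z in A is enough to separate, because the point to be
    separated from Z lies in A. *)
Lemma closed_in_separation (A Z Z' : set rp) :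
  closed_in A Z -> Z' `<=` A -> ~ Z' `<=` Z ->
  exists m f, [/\ regular m f, forall X, Z X -> f X = 0 &
                  exists2 X, Z' X & f X != 0].
Proof.
move=> [_ [S ->] ->] Z'A /existsNP[X /not_implyP[Z'X]].
move=> /not_andP[/(_ (Z'A X Z'X)) // | /existsNP[p /not_implyP[Sp /eqP pX]]].
have [m pm] := meval_polyfun (@coords K I Q d) p.
exists m, (fun Y => mpoly.meval (coords Y) p); split => //; last by exists X.
by move=> Y [_]; apply.
Qed.

Definition lin_indep_on (Z : set rp) (J : finType) (u : J -> rp -> K) : Prop :=
  forall a : J -> K,
    (forall X, Z X -> \sum_j a j * u j X = 0) -> forall j, a j = 0.

(** In a vanishing combination of the u_j f^k, let k be the least exponent that
    occurs.  On the irreducible set Z' the factor f^k can be cancelled, and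
    then on Z only the terms with exponent k survive; they form a combination
    of the u_j alone. *)
Lemma lin_indep_on_powers (Z Z' : set rp) (J : finType) (u : J -> rp -> K)
    (f : rp -> K) m n D :
  Z `<=` Z' -> irreducible Z' -> regular m f -> (forall j, regular n (u j)) ->
  (forall X, Z X -> f X = 0) -> (exists2 X, Z' X & f X != 0) ->
  lin_indep_on Z u ->
  lin_indep_on Z' (fun (jk : J * 'I_D) X => u jk.1 X * f X ^+ jk.2).
Proof.
move=> ZZ' irrZ' pf pu f0 [X0 Z'X0 fX0] indu a a0.
suff ak0 (k : nat) (ltkD : (k < D)%N) j : a (j, Ordinal ltkD) = 0.
  by move=> [j [k ltkD]]; apply: ak0.
elim/ltn_ind: k => k IHk in ltkD j *.
pose rest X := \sum_(l < D | (k <= l)%N)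
  (\sum_j a (j, l) * u j X) * f X ^+ (l - k).
have a_small (l : 'I_D) i : (l < k)%N -> a (i, l) = 0.
  by case: l => l ltlD ltlk; apply: IHk.
have prest : exists r, regular r rest.
  exists (n + m * D)%N; apply: polyfun_sum => l; apply: polyfun_mul.
    by apply: polyfun_sum => i; apply: polyfun_scale.
  apply: polyfun_le (polyfun_exp _ pf); rewrite leq_mul2l; apply/orP; right.
  by apply: leq_trans (leq_subr _ _) (ltnW (ltn_ord l)).
have [r pr] := prest.
have fk_rest X : Z' X -> f X ^+ k * rest X = 0.
  move=> Z'X; rewrite -[RHS](a0 X Z'X) /rest mulr_sumr.
  have -> : \sum_(jl : J * 'I_D) a jl * (u jl.1 X * f X ^+ jl.2) =
      \sum_j \sum_(l < D) a (j, l) * (u j X * f X ^+ l).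
    by rewrite pair_bigA; apply: eq_bigr => -[].
  rewrite exchange_big /= [RHS](bigID (fun l : 'I_D => (k <= l)%N)) /=.
  rewrite [X in _ = _ + X]big1 ?addr0 => [|l]; last first.
    rewrite -ltnNge => ltlk; apply: big1 => i _.
    by rewrite a_small // mul0r.
  apply: eq_bigr => l lekl; rewrite mulrCA -exprD subnKC // mulr_suml.
  by apply: eq_bigr => i _; rewrite mulrA.
case: (irreducible_mul_eq0 irrZ' (polyfun_exp k pf) pr fk_rest) => [fk0|rest0].
  by have := expf_neq0 k fX0; rewrite fk0 ?eqxx.
apply: (indu (fun i => a (i, Ordinal ltkD))) => X ZX.
(* On Z the powers of f with positive exponent vanish. *)
rewrite -[RHS](rest0 X (ZZ' X ZX)) /rest (bigD1 (Ordinal ltkD)) //=.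
rewrite subnn expr0 mulr1 [X in _ = _ + X]big1 ?addr0 // => l /andP[lekl nel].
have ltkl : (k < l)%N.
  by rewrite ltn_neqAle lekl andbT; apply: contra nel => /eqP ekl; apply/eqP/val_inj.
by rewrite f0 // expr0n subn_eq0 leqNgt ltkl mulr0.
Qed.

(** E depends on the chain but not on D: each step of the chain contributes one
    separating function, raised to powers below D. *)
Lemma chain_lin_indep (A : set rp) (Z : nat -> set rp) n :
  (forall k, (k <= n)%N -> closed_in A (Z k) /\ irreducible (Z k)) ->
  (forall k, (k < n)%N -> Z k `<` Z k.+1) ->
  exists E, forall D, exists (J : finType) (u : J -> rp -> K),
    [/\ #|J| = (D ^ n)%N, forall j, regular (E * D) (u j) &
        lin_indep_on (Z n) u].
Proof.
elim: n => [|n IHn] irrZ ltZ.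
  exists 0%N => D; exists unit, (fun _ _ => 1); split.
  - by rewrite card_unit.
  - by move=> _; apply: polyfun_const.
  - move=> a a0 []; have [_ [[X ZX] _]] := irrZ 0%N (leqnn _).
    have := a0 X ZX; rewrite (big_pred1 tt) ?mulr1 //.
have [E IH] := IHn (fun k lekn => irrZ k (leqW lekn))
                   (fun k ltkn => ltZ k (leqW ltkn)).
have [clZ irr'] := irrZ n.+1 (leqnn _).
have [ZZ' nZ'Z] := ltZ n (leqnn _).
have Z'A : Z n.+1 `<=` A by case: clZ => F _ -> X [].
have [m [f [pf f0 fn0]]] :=
  closed_in_separation (proj1 (irrZ n (leqnSn n))) Z'A nZ'Z.
exists (E + m)%N => D; have [J [u [cardJ pu indu]]] := IH D.
exists (J * 'I_D)%type, (fun (jk : J * 'I_D) X => u jk.1 X * f X ^+ jk.2); split.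
- by rewrite card_prod cardJ card_ord expnSr.
- move=> [j k] /=; rewrite mulnDl; apply: polyfun_mul (pu j) _.
  apply: polyfun_le (polyfun_exp _ pf); rewrite leq_mul2l.
  by rewrite (ltnW (ltn_ord k)) orbT.
- exact: (lin_indep_on_powers ZZ' irr' pf pu f0 fn0 indu).
Qed.

(** If n exceeded the number of parameters, there would be more functions u_j
    than monomials available to all the #|P| pullbacks together, so a single
    nontrivial combination would vanish on every image. *)
Lemma irr_chain_le_parameters (A : set rp) (P C : finType)
    (phi : P -> (C -> K) -> rp) F n :
  (forall p k, polyfun (fun c (theta : C -> K) => theta c) F
                 (fun theta => coords (phi p theta) k)) ->
  (forall X, A X -> exists p theta, X = phi p theta) ->
  irr_chain A n -> (n <= #|C|)%N.
Proof.
move=> pphi covA [Z [irrZ ltZ]]; rewrite leqNgt; apply/negP => ltCn.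
have [E indZ] := chain_lin_indep irrZ ltZ.
have [D ltD] := exists_expn_gt (E * F) #|P| ltCn.
have [J [u [cardJ pu indu]]] := indZ D.
have span_u j p : in_monomial_span (fun c (theta : C -> K) => theta c)
    (E * F * D) (fun theta => u j (phi p theta)).
  apply: polyfun_in_monomial_span; rewrite mulnAC.
  exact: polyfun_comp (pphi p) (pu j).
have [a ua] : exists a : J -> P -> {ffun C -> 'I_(E * F * D).+1} -> K,
    forall j p theta, u j (phi p theta) =
      \sum_e a j p e * monomial (fun c (theta : C -> K) => theta c) e theta.
  by exists (fun j p => sval (cid (span_u j p))) => j p; case: cid.
have [|v [j vj] v0] :=
    exists_dependence (fun j (b : P * {ffun C -> 'I_(E * F * D).+1}) => a j b.1 b.2).
  by rewrite cardJ card_prod card_ffun card_ord.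
move/eqP: vj; apply; apply: indu => X ZX.
have AX : A X by case: (irrZ n (leqnn n)) => -[G _ ZG] _; move: ZX; rewrite ZG => -[].
have [p [theta ->]] := covA X AX.
under eq_bigr do rewrite ua mulr_sumr.
rewrite exchange_big big1 //= => e _.
under eq_bigr do rewrite mulrA.
by rewrite -mulr_suml (v0 (p, e)) mul0r.
Qed.

End Chains.

(** * Dimension of the representation space *)

Section AffineSpace.
Local Open Scope classical_set_scope.
Variable K : fieldType.
Hypothesis char0 : [pchar K] =i pred0.

Lemma poly_fun_eq0 (p : {poly K}) : (forall t, p.[t] = 0) -> p = 0.
Proof.
move=> p0; apply/eqP; apply/negPn/negP => pn0.
pose s := [seq n%:R : K | n <- iota 0 (size p)].
have : (size s < size p)%N.
  apply: (max_poly_roots pn0); first by apply/allP => t _; rewrite /root p0.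
  rewrite map_inj_uniq ?iota_uniq // => m n; wlog lemn : m n / (m <= n)%N.
    by move=> W; case/orP: (leq_total m n) => [/W // | /W nm /esym/nm].
  move/eqP; rewrite eq_sym -subr_eq0 -natrB // => /eqP/eqP.
  rewrite ((pcharf0P K).1 char0) subn_eq0 => lenm.
  by apply/eqP; rewrite eqn_leq lemn.
by rewrite size_map size_iota ltnn.
Qed.

Variables (I : finType) (Q : quiver I) (d : dimvec I).
Local Notation N := #|rep_coord Q d|.

Definition rep_of_coords (v : 'I_N -> K) : rep K Q d :=
  fun a => \matrix_(r, c) v (enum_rank (Tagged
    (fun b : arrow Q => ('I_(d (src b)) * 'I_(d (tgt b)))%type) (r, c))).

Lemma rep_of_coordsK v k : coords (rep_of_coords v) k = v k.
Proof.
rewrite /coords mxE -[in RHS](enum_valK k); congr (v (enum_rank _)).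
by case: (enum_val k) => a [].
Qed.

Lemma coordsK (X : rep K Q d) : rep_of_coords (coords X) = X.
Proof.
apply: functional_extensionality_dep => a; apply/matrixP => r c.
by rewrite mxE /coords enum_rankK.
Qed.

Definition coord_subspace n : set (rep K Q d) :=
  [set X | forall k : 'I_N, (n <= k)%N -> coords X k = 0].

Lemma zariski_closed_coord_subspace n : zariski_closed (coord_subspace n).
Proof.
exists [set p | exists2 k : 'I_N, (n <= k)%N & p = mpoly.mpolyX K (mpoly.mnm1 k)].
apply/seteqP; split=> X /= X0.
  by move=> _ [k lenk ->]; rewrite mpoly.mevalXU X0.
by move=> k lenk; rewrite -(mpoly.mevalXU (coords X)); apply: X0; exists k.
Qed.

(** If f and g each take a nonzero value on a linear subspace, say at X and Y,
    then their restrictions to the line XY are nonzero univariate polynomials,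
    so f g is nonzero somewhere on that line, K being infinite. *)
Lemma irreducible_coord_subspace n : irreducible (coord_subspace n).
Proof.
split; first by exists (rep_of_coords (fun=> 0)) => k _; rewrite rep_of_coordsK.
move=> _ _ [S ->] [S' ->] VFG; apply: contrapT => /not_orP[].
move=> /existsNP[X /not_implyP[VX /existsNP[f /not_implyP[Sf /eqP fX]]]].
move=> /existsNP[Y /not_implyP[VY /existsNP[g /not_implyP[Sg /eqP gY]]]].
pose l t := rep_of_coords (fun k => coords X k + t * (coords Y k - coords X k)).
have l0 : l 0 = X.
  rewrite -[RHS]coordsK /l; congr rep_of_coords; apply: funext => k.
  by rewrite mul0r addr0.
have l1 : l 1 = Y.
  rewrite -[RHS]coordsK /l; congr rep_of_coords; apply: funext => k.
  by rewrite mul1r addrC subrK.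
have line_coord k : exists p : {poly K}, forall t, coords (l t) k = p.[t].
  exists ((coords X k)%:P + (coords Y k - coords X k) *: 'X) => t.
  by rewrite rep_of_coordsK !hornerE mulrC.
have [m pf] := meval_polyfun (@coords K I Q d) f.
have [m' pg] := meval_polyfun (@coords K I Q d) g.
have [p fp] := polyfun_line line_coord pf.
have [q gq] := polyfun_line line_coord pg.
have /eqP : p * q = 0.
  apply: poly_fun_eq0 => t; rewrite hornerM -fp -gq.
  have Vlt : coord_subspace n (l t).
    by move=> k lenk; rewrite rep_of_coordsK (VX k lenk) (VY k lenk) subrr mulr0 addr0.
  by case: (VFG _ Vlt) => /= [/(_ f Sf) ->|/(_ g Sg) ->]; rewrite ?mul0r ?mulr0.
rewrite mulf_eq0 => /orP[] /eqP r0.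
  by move: fX; rewrite -l0 fp r0 horner0 eqxx.
by move: gY; rewrite -l1 gq r0 horner0 eqxx.
Qed.

Lemma irr_chain_setT : irr_chain (setT : set (rep K Q d)) N.
Proof.
exists coord_subspace; split=> k lekN.
  split; last exact: irreducible_coord_subspace.
  exists (coord_subspace k); last by rewrite setTI.
  exact: zariski_closed_coord_subspace.
split; first by move=> X VX j ltkj; apply: VX; apply: ltnW.
pose X := rep_of_coords (fun j => (j == Ordinal lekN)%:R).
move=> /(_ X) VX; have : coord_subspace k X.
  apply: VX => j ltkj; rewrite rep_of_coordsK.
  by rewrite -val_eqE /= gtn_eqF.
move=> /(_ (Ordinal lekN) (leqnn k)) /eqP.
by rewrite rep_of_coordsK eqxx oner_eq0.
Qed.

(** The maximum in the definition of the dimension exists because the identity,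
    a parametrization of the whole space, bounds all chains. *)
Lemma krull_dim_setT : krull_dim (setT : set (rep K Q d)) = N.
Proof.
have leN m : irr_chain (setT : set (rep K Q d)) m -> (m <= N)%N.
  move=> chain; rewrite -[X in (_ <= X)%N]card_ord.
  apply: (@irr_chain_le_parameters K I Q d setT unit 'I_N
    (fun _ => rep_of_coords) 1) chain.
    move=> _ k; apply: polyfun_ext (polyfun_coord _ k) => theta.
    by rewrite rep_of_coordsK.
  by move=> X _; exists tt, (coords X); rewrite coordsK.
apply: xget_unique; first by split; [exact: irr_chain_setT | exact: leN].
move=> m [chain_m maxm]; apply/eqP; rewrite eqn_leq leN //=.
exact/maxm/irr_chain_setT.
Qed.

End AffineSpace.

(** Unbounded chains are excluded by the hypothesis, and in any case the default
    value 0 satisfies the bound. *)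
Lemma krull_dim_le (K : fieldType) (I : finType) (Q : quiver I) (d : dimvec I)
    (A : set (rep K Q d)) m :
  (forall n, irr_chain A n -> (n <= m)%N) -> (krull_dim A <= m)%N.
Proof.
by move=> chain_le; rewrite /krull_dim; case: xgetP => [n _ [/chain_le]|].
Qed.

(** * Parametrizing extensions *)

Section NormalForm.
Variable K : fieldType.

(** The lower n rows are the coordinates of a subspace complementary to the
    first m coordinate axes, up to the permutation s: the standard charts of
    the Grassmannian. *)
Definition shear m n (s : 'S_(m + n)) (y : 'M[K]_(n, m)) : 'M[K]_(m + n) :=
  block_mx 1%:M 0 y 1%:M *m perm_mx s.

Definition shear_inv m n (s : 'S_(m + n)) (y : 'M[K]_(n, m)) : 'M[K]_(m + n) :=
  perm_mx s^-1%g *m block_mx 1%:M 0 (- y) 1%:M.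

Lemma shear_invK m n (s : 'S_(m + n)) (y : 'M[K]_(n, m)) :
  shear_inv s y *m shear s y = 1%:M.
Proof.
rewrite /shear_inv /shear mulmxA -[X in X *m _]mulmxA mulmx_block.
rewrite !mulmx1 !mul1mx !mulmx0 !mul0mx !addr0 addNr add0r -scalar_mx_block mulmx1.
by rewrite -perm_mxM mulVg perm_mx1.
Qed.

Lemma shearK m n (s : 'S_(m + n)) (y : 'M[K]_(n, m)) :
  shear s y *m shear_inv s y = 1%:M.
Proof. exact/mulmx1C/shear_invK. Qed.

Lemma inj_extends_perm m n (f : 'I_m -> 'I_(m + n)) :
  injective f -> exists s : 'S_(m + n), forall i, s (lshift n i) = f i.
Proof.
move=> injf; pose B := ~: [set f i | i in 'I_m].
have cardB : n = #|B|.
  by rewrite cardsCs finset.setCK card_imset // !card_ord addKn.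
pose h (k : 'I_(m + n)) := match split k with
  | inl i => f i | inr j => enum_val (cast_ord cardB j) end.
have injh : injective h.
  have BfP j i : enum_val (cast_ord cardB j) <> f i.
    move=> E; have := enum_valP (cast_ord cardB j).
    by rewrite E inE imset_f.
  move=> k l; rewrite /h; case: (splitP k) => i ki; case: (splitP l) => j lj.
  - by move=> /injf ij; apply: val_inj; rewrite /= ki lj ij.
  - by move/esym/BfP.
  - by move/BfP.
  - by move=> /enum_val_inj/cast_ord_inj ij; apply: val_inj; rewrite /= ki lj ij.
exists (perm injh) => i; rewrite permE /h.
by rewrite (_ : lshift n i = unsplit (inl i)) // unsplitK.
Qed.

(** Some m rows of a surjection K^(m + n) -> K^m are independent; moving them
    to the front puts the kernel in the chart of subspaces complementary to
    the first m coordinates, where it is the row space of (y 1). Finitely many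
    permutations s therefore suffice, each with m n parameters y. *)
Lemma row_full_shear m n (g : 'M[K]_(m + n, m)) : row_full g ->
  exists (s : 'S_(m + n)) (y : 'M_(n, m)) (u : 'M_m),
    u \in unitmx /\ shear s y *m g = col_mx u 0.
Proof.
move=> fullg.
have [s sf] := inj_extends_perm (fullrankfun_inj (rkA := fullg)).
pose u := usubmx (perm_mx s *m g); pose v := dsubmx (perm_mx s *m g).
have uU : u \in unitmx.
  rewrite (_ : u = rowsub (fullrankfun fullg) g) ?fullrowsub_unit //.
  by apply/matrixP => i j; rewrite /u -row_permE !mxE sf.
exists s, (- (v *m invmx u)), u; split=> //.
rewrite /shear -mulmxA -[perm_mx s *m g]vsubmxK mul_block_col.
by rewrite !mul1mx mul0mx addr0 mulNmx mulmxKV // addNr.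
Qed.

Variables (I : finType) (Q : quiver I).

Definition rep_iso (d : dimvec I) (X Y : rep K Q d) : Prop :=
  exists2 h : forall i, 'M[K]_(d i), forall i, h i \in unitmx & rep_hom X Y h.

Lemma short_exact_iso (d e x : dimvec I) (N : rep K Q e) (X Y : rep K Q x)
    (M : rep K Q d) : rep_iso X Y -> short_exact N X M -> short_exact N Y M.
Proof.
move=> [h hU XY] [f [g [Nf Xg fg]]].
exists (fun i => f i *m h i), (fun i => invmx (h i) *m g i); split.
- by move=> a; rewrite mulmxA Nf -mulmxA XY mulmxA.
- move=> a; apply: (can_inj (mulKmx (hU (src a)))).
  by rewrite !mulmxA -XY mulmxK // mulmxV // mul1mx.
- move=> i; have [freef fullg /eqmxP kerg] := fg i.
  have hfull : row_full (h i) by rewrite row_full_unit.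
  have h'free : row_free (invmx (h i)) by rewrite row_free_unit unitmx_inv.
  split.
  + by rewrite /row_free mxrankMfree // row_free_unit.
  + rewrite /row_full -mxrank_tr trmx_mul mxrankMfree ?mxrank_tr //.
    by rewrite row_free_unit unitmx_tr unitmx_inv.
  + apply/andP; split.
      apply/sub_kermxP; rewrite mulmxA mulmxK //.
      by apply/sub_kermxP; rewrite kerg.
    rewrite -[kermx _](mulmxKV (hU i)); apply: submxMr.
    rewrite kerg; apply/sub_kermxP.
    by rewrite -mulmxA mulmx_ker.
Qed.

(** An extension of an arbitrary representation of dimension b by N, in the
    basis given by the rows of the shears: the zero block says that the lower
    rows span a subrepresentation, and U is unconstrained. *)
Definition glue (b e : dimvec I) (s : forall i, 'S_(b i + e i))
    (y : forall i, 'M[K]_(e i, b i))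
    (U : forall a : arrow Q, 'M[K]_(b (src a), b (tgt a) + e (tgt a)))
    (N : rep K Q e) : rep K Q (dvadd b e) :=
  fun a => shear_inv (s (src a)) (y (src a)) *m
    col_mx (U a) (row_mx 0 (N a)) *m shear (s (tgt a)) (y (tgt a)).

(** The isomorphism from N to N' is unavoidable, as the injection N -> X is only
    determined up to a choice of basis of its image; this is why the
    parametrizations below are required to reach all representations
    isomorphic to a given one. *)
Lemma short_exact_glue (b e : dimvec I) (N : rep K Q e)
    (X : rep K Q (dvadd b e)) (M : rep K Q b) :
  short_exact N X M ->
  exists s y U N', rep_iso N N' /\ X = glue s y U N'.
Proof.
move=> [f [g [Nf Xg fg]]].
have shear_g i : exists (syu : 'S_(b i + e i) * 'M[K]_(e i, b i) * 'M[K]_(b i)),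
    syu.2 \in unitmx /\ shear syu.1.1 syu.1.2 *m g i = col_mx syu.2 0.
  have [_ fullg _] := fg i; have [s [y [u [uU sy]]]] := row_full_shear fullg.
  by exists (s, y, u).
pose s i := (sval (cid (shear_g i))).1.1; pose y i := (sval (cid (shear_g i))).1.2.
have [P PE] : exists P : forall i, 'M[K]_(b i + e i),
    forall i, P i = shear (s i) (y i) by exists (fun i => shear (s i) (y i)).
have [P' P'E] : exists P' : forall i, 'M[K]_(b i + e i),
    forall i, P' i = shear_inv (s i) (y i).
  by exists (fun i => shear_inv (s i) (y i)).
have P'P i : P' i *m P i = 1%:M by rewrite PE P'E shear_invK.
have PP' i : P i *m P' i = 1%:M by rewrite PE P'E shearK.
have f_sub i : exists2 h : 'M[K]_(e i), h \in unitmx & f i = row_mx 0 h *m P i.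
  have [u uU Pg] : exists2 u, u \in unitmx & P i *m g i = col_mx u 0.
    by rewrite PE /s /y; case: cid => -[[s0 y0] u] /= [uU]; exists u.
  have [freef _ /eqmxP kerg] := fg i.
  have Ef : f i = row_mx (lsubmx (f i *m P' i)) (rsubmx (f i *m P' i)) *m P i.
    by rewrite hsubmxK -mulmxA P'P mulmx1.
  have f1 : lsubmx (f i *m P' i) = 0.
    have : f i *m g i = 0 by apply/sub_kermxP; rewrite kerg.
    rewrite {1}Ef -mulmxA Pg mul_row_col mulmx0 addr0 => /(congr1 (mulmx^~ (invmx u))).
    by rewrite mulmxK // mul0mx.
  exists (rsubmx (f i *m P' i)); last by rewrite {1}Ef f1.
  rewrite -row_free_unit -row_leq_rank.
  have := freef; rewrite -row_leq_rank => /leq_trans; apply.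
  have fM : f i = rsubmx (f i *m P' i) *m (row_mx 0 1%:M *m P i).
    by rewrite mulmxA mul_mx_row mulmx0 mulmx1 {1}Ef f1.
  by rewrite {1}fM mxrankM_maxl.
have [h hU fh] : exists2 h : forall i, 'M[K]_(e i), forall i, h i \in unitmx &
    forall i, f i = row_mx 0 (h i) *m P i.
  by exists (fun i => s2val (cid2 (f_sub i))) => i; case: cid2.
pose X' a : 'M[K]_(b (src a) + e (src a), b (tgt a) + e (tgt a)) := X a.
pose Y a := P (src a) *m X' a *m P' (tgt a).
have XY a : X' a = P' (src a) *m Y a *m P (tgt a).
  by rewrite /Y !mulmxA P'P mul1mx -mulmxA P'P mulmx1.
have hom_h a : row_mx 0 (N a *m h (tgt a)) =
    row_mx (h (src a) *m dlsubmx (Y a)) (h (src a) *m drsubmx (Y a)).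
  have : N a *m f (tgt a) = f (src a) *m X' a := Nf a.
  rewrite !fh => /(congr1 (mulmx^~ (P' (tgt a)))).
  rewrite -!mulmxA PP' mulmx1 mul_mx_row mulmx0 => ->.
  rewrite !mulmxA -2!mulmxA [P _ *m (_ *m _)]mulmxA -/(Y a).
  rewrite -{1}[Y a]submxK mul_row_block !mul0mx !add0r.
  by [].
have Ydl a : dlsubmx (Y a) = 0.
  have [/(congr1 (mulmx (invmx (h (src a)))))] := eq_row_mx (hom_h a).
  by rewrite mulmx0 mulKmx.
exists s, y, (fun a => usubmx (Y a)), (fun a => drsubmx (Y a)); split.
  by exists h => // a; have [_] := eq_row_mx (hom_h a).
apply: functional_extensionality_dep => a; rewrite /glue -[LHS]/(X' a) XY.
by rewrite PE P'E -(Ydl a) /dlsubmx /drsubmx hsubmxK vsubmxK.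
Qed.

End NormalForm.

(** * Parametrizing word varieties *)

Section PolynomialMatrices.
Variables (K : fieldType) (T C : Type) (x : C -> T -> K).

Definition polymx m n k (A : T -> 'M[K]_(m, n)) : Prop :=
  forall i j, polyfun x k (fun t => A t i j).

Lemma polymx_le m n k l (A : T -> 'M[K]_(m, n)) :
  (k <= l)%N -> polymx k A -> polymx l A.
Proof. by move=> lekl pA i j; apply: polyfun_le (pA i j). Qed.

Lemma polymx_const m n k (A : 'M[K]_(m, n)) : polymx k (fun=> A).
Proof. by move=> i j; apply: polyfun_le (polyfun_const _ _). Qed.

Lemma polymx_mul m n p k l (A : T -> 'M[K]_(m, n)) (B : T -> 'M[K]_(n, p)) :
  polymx k A -> polymx l B -> polymx (k + l) (fun t => A t *m B t).
Proof.
move=> pA pB i j; apply: polyfun_ext (polyfun_sum _ _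
  (fun c => polyfun_mul (pA i c) (pB c j))) => t.
by rewrite mxE.
Qed.

Lemma polymx_opp m n k (A : T -> 'M[K]_(m, n)) :
  polymx k A -> polymx k (fun t => - A t).
Proof.
move=> pA i j; apply: polyfun_ext (polyfun_scale (-1) (pA i j)) => t.
by rewrite mxE mulN1r.
Qed.

Lemma polymx_row m n p k (A : T -> 'M[K]_(m, n)) (B : T -> 'M[K]_(m, p)) :
  polymx k A -> polymx k B -> polymx k (fun t => row_mx (A t) (B t)).
Proof.
move=> pA pB i j; case: (split_ordP j) => l ->.
  by apply: polyfun_ext (pA i l) => t; rewrite row_mxEl.
by apply: polyfun_ext (pB i l) => t; rewrite row_mxEr.
Qed.

Lemma polymx_col m n p k (A : T -> 'M[K]_(m, n)) (B : T -> 'M[K]_(p, n)) :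
  polymx k A -> polymx k B -> polymx k (fun t => col_mx (A t) (B t)).
Proof.
move=> pA pB i j; case: (split_ordP i) => l ->.
  by apply: polyfun_ext (pA l j) => t; rewrite col_mxEu.
by apply: polyfun_ext (pB l j) => t; rewrite col_mxEd.
Qed.

Lemma polymx_shear m n (s : 'S_(m + n)) (y : T -> 'M[K]_(n, m)) :
  polymx 1 y -> polymx 1 (fun t => shear s (y t)).
Proof.
move=> py; rewrite -[1%N]addn0; apply: polymx_mul; last exact: polymx_const.
by apply: polymx_col; apply: polymx_row => //; apply: polymx_const.
Qed.

Lemma polymx_shear_inv m n (s : 'S_(m + n)) (y : T -> 'M[K]_(n, m)) :
  polymx 1 y -> polymx 1 (fun t => shear_inv s (y t)).
Proof.
move=> py; rewrite -[1%N]add0n; apply: polymx_mul; first exact: polymx_const.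
apply: polymx_col; apply: polymx_row; try exact: polymx_const => //.
exact: polymx_opp.
Qed.

End PolynomialMatrices.

Section WordVarieties.
Local Open Scope classical_set_scope.
Variables (K : fieldType) (I : finType) (Q : quiver I).

Definition polyparam (d : dimvec I) (P C : finType)
    (phi : P -> (C -> K) -> rep K Q d) : Prop :=
  exists F, forall p a,
    polymx (fun c (theta : C -> K) => theta c) F (fun theta => phi p theta a).

Section Extend.
Variables (b e : dimvec I) (P C : finType) (phi : P -> (C -> K) -> rep K Q e).

(** The three summands carry the entries of the y, the entries of the U and the
    parameters of the subrepresentation. *)
Definition ext_coord : finType :=
  ({i : I & 'I_(e i) * 'I_(b i)} +
   {a : arrow Q & 'I_(b (src a)) * 'I_(b (tgt a) + e (tgt a))} + C)%type.

Definition ext_chart : finType :=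
  ({dffun forall i : I, 'S_(b i + e i)} * P)%type.

Definition ext_param (p : ext_chart) (theta : ext_coord -> K) :
    rep K Q (dvadd b e) :=
  glue p.1
    (fun i => \matrix_(r, c) theta (inl (inl (Tagged
      (fun i : I => ('I_(e i) * 'I_(b i))%type) (r, c)))))
    (fun a : arrow Q => \matrix_(r, c) theta (inl (inr (Tagged
      (fun a : arrow Q =>
         ('I_(b (src a)) * 'I_(b (tgt a) + e (tgt a)))%type) (r, c)))))
    (phi p.2 (fun c => theta (inr c))).

Lemma polyparam_ext : polyparam phi -> polyparam ext_param.
Proof.
move=> [F pphi]; exists (1 + F.+1 + 1)%N => p a.
have pcoord m n (c : 'I_m -> 'I_n -> ext_coord) :
    polymx (fun c (theta : ext_coord -> K) => theta c) 1
      (fun theta => \matrix_(i, j) theta (c i j)).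
  move=> i j; apply: polyfun_ext (polyfun_coord _ (c i j)) => theta.
  by rewrite mxE.
apply: polymx_mul; last exact/polymx_shear/pcoord.
apply: polymx_mul; first exact/polymx_shear_inv/pcoord.
apply: polymx_col; first by apply: polymx_le (pcoord _ _ _).
apply: polymx_row; first exact: polymx_const.
apply: (polymx_le (leqnSn F)) => i j.
rewrite -[F]muln1; apply: polyfun_comp (pphi p.2 a i j) => c.
exact: polyfun_coord.
Qed.

Lemma ext_param_surj (s : forall i, 'S_(b i + e i)) y U p theta :
  exists q eta, glue s y U (phi p theta) = ext_param q eta.
Proof.
exists ([ffun i => s i], p), (fun c => match c with
  | inl (inl u) => y (tag u) (tagged u).1 (tagged u).2
  | inl (inr u) => U (tag u) (tagged u).1 (tagged u).2
  | inr c => theta c end).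
rewrite /ext_param /=; congr glue.
- by apply: functional_extensionality_dep => i; rewrite ffunE.
- by apply: functional_extensionality_dep => i; apply/matrixP => r c; rewrite mxE.
- by apply: functional_extensionality_dep => a; apply/matrixP => r c; rewrite mxE.
Qed.

Lemma card_ext_coord : #|ext_coord| =
  (\sum_i e i * b i + \sum_(a : arrow Q) b (src a) * (b (tgt a) + e (tgt a)) + #|C|)%N.
Proof.
rewrite !card_sum !card_tagged !sumnE !big_map -!enumT !big_enum /=.
by congr (_ + _ + _)%N; apply: eq_bigr => i _; rewrite card_prod !card_ord.
Qed.

End Extend.

(** In a basis adapted to the filtration these count the matrix entries that
    have to vanish: they would map a step of the filtration out of itself. *)
Definition back_arrows (w : seq I) : nat :=
  \sum_(l < size w) \sum_(k < size w | (k < l)%N)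
    arrows_from_to Q (tnth (in_tuple w) l) (tnth (in_tuple w) k).

(** The dimension of the product of the full flag varieties of the K^(d_i). *)
Definition flag_dim (d : dimvec I) : nat := \sum_i (d i * (d i - 1)) %/ 2.

Lemma card_rep_coord (d : dimvec I) :
  #|rep_coord Q d| = (\sum_(a : arrow Q) d (src a) * d (tgt a))%N.
Proof.
rewrite card_tagged sumnE big_map big_enum.
by apply: eq_bigr => a _; rewrite card_prod !card_ord.
Qed.

Lemma flag_dim_cons i w :
  flag_dim (weight (i :: w)) =
  (flag_dim (weight w) + \sum_j weight w j * sigma i j)%N.
Proof.
rewrite /flag_dim -big_split /=; apply: eq_bigr => j _.
rewrite /dvadd /sigma; case: (i == j); last by rewrite muln0 addn0.
by rewrite !divn2 !subn1 -!bin2 muln1 add1n binS bin1.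
Qed.

Lemma back_arrows_cons i w :
  back_arrows (i :: w) =
  (back_arrows w + \sum_(a : arrow Q) weight w (src a) * sigma i (tgt a))%N.
Proof.
have -> : (\sum_(a : arrow Q) weight w (src a) * sigma i (tgt a) =
    \sum_(l < size w) arrows_from_to Q (tnth (in_tuple w) l) i)%N.
  transitivity (\sum_(j <- w) arrows_from_to Q j i)%N; last by rewrite big_tnth.
  elim: w => [|j w IHw]; first by rewrite big_nil big1.
  rewrite big_cons -IHw /arrows_from_to -sum1_card [in RHS]big_mkcond -big_split /=.
  apply: eq_bigr => a _; rewrite /dvadd /sigma mulnDl eq_sym [i == _]eq_sym.
  by rewrite unfold_in /=; case: (_ == j); case: (_ == i).
rewrite /back_arrows /= big_ord_recl big1 ?add0n; last by move=> k; rewrite ltn0.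
rewrite -big_split /=; apply: eq_bigr => l _.
rewrite big_mkcond big_ord_recl /= addnC -big_mkcond /=.
by congr (_ + _)%N; first apply: eq_big => // k; rewrite ?ltnS // !(tnth_nth i).
Qed.

(** Splitting off the first letter i adds as parameters a hyperplane at i and
    the blocks U.  The entries of the new representation that are neither in U
    nor in the subrepresentation are those of the zero blocks, one for each
    arrow from a later letter to i. *)
Lemma word_variety_param (w : seq I) :
  exists (P C : finType) (phi : P -> (C -> K) -> rep K Q (weight w)),
  [/\ polyparam phi,
      forall X Y, word_variety K Q w X -> rep_iso X Y ->
        exists p theta, Y = phi p theta &
      (#|C| + back_arrows w = #|rep_coord Q (weight w)| + flag_dim (weight w))%N].
Proof.
elim: w => [|i w [P [C [phi [pphi surj cardC]]]]].
  exists unit, void, (fun _ _ _ => 0); split.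
  - by exists 0%N => _ a; apply: polymx_const.
  - move=> X Y _ _; exists tt, (fun=> 0).
    by apply: functional_extensionality_dep => a; apply/matrixP => -[].
  - rewrite card_rep_coord /back_arrows /flag_dim big_ord0 card_void.
    by rewrite !big1.
exists (ext_chart (sigma i) (weight w) P), (ext_coord (sigma i) (weight w) C),
  (@ext_param (sigma i) (weight w) P C phi); split.
- exact: polyparam_ext.
- move=> X Y [M [N [_ WN exNXM]]] XY.
  have [s [y [U [N' [NN' ->]]]]] :=
    short_exact_glue (short_exact_iso XY exNXM).
  have [p [theta ->]] := surj N N' WN NN'.
  exact: ext_param_surj.
- rewrite card_ext_coord back_arrows_cons flag_dim_cons.
  move: cardC; rewrite !card_rep_coord /= => cardC.
  have -> : (\sum_(a : arrow Q) dvadd (sigma i) (weight w) (src a) *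
                    dvadd (sigma i) (weight w) (tgt a) =
     \sum_(a : arrow Q) sigma i (src a) * (sigma i (tgt a) + weight w (tgt a)) +
     (\sum_(a : arrow Q) weight w (src a) * sigma i (tgt a) +
      \sum_(a : arrow Q) weight w (src a) * weight w (tgt a)))%N.
    rewrite -!big_split /=; apply: eq_bigr => a _.
    by rewrite /dvadd mulnDl [in X in (_ + X)%N]mulnDr.
  lia.
Qed.

End WordVarieties.

(** * The codimension estimate *)

Theorem theorem3p5 (K : closedFieldType) (char0 : [pchar K] =i pred0)
    (I : finType) (Q : quiver I) (Qacyclic : acyclic Q) (w : seq I) :
  - (\sum_(i : I) ((weight w i * (weight w i - 1)) %/ 2)%N%:Z)
  + \sum_(l < size w) \sum_(k < size w | (k < l)%N)
      (arrows_from_to Q (tnth (in_tuple w) l) (tnth (in_tuple w) k))%:Z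
  <= codim (word_variety K Q w).
Proof.
have [P [C [phi [[F pphi] surj cardC]]]] := word_variety_param K Q w.
have dimW : (krull_dim (word_variety K Q w) <= #|C|)%N.
  apply: krull_dim_le => n; apply: (irr_chain_le_parameters (phi := phi)).
    move=> p k; exact: pphi.
  move=> X WX; apply: (surj X X WX); exists (fun i => 1%:M) => [i|a].
    exact: unitmx1.
  by rewrite mulmx1 mul1mx.
have -> : \sum_(l < size w) \sum_(k < size w | (k < l)%N)
    (arrows_from_to Q (tnth (in_tuple w) l) (tnth (in_tuple w) k))%:Z
    = (back_arrows Q w)%:Z.
  rewrite /back_arrows (big_morph Posz PoszD (erefl _)).
  by apply: eq_bigr => l _; rewrite (big_morph Posz PoszD (erefl _)).
have -> : \sum_i ((weight w i * (weight w i - 1)) %/ 2)%N%:Z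
    = (flag_dim (weight w))%:Z.
  by rewrite /flag_dim (big_morph Posz PoszD (erefl _)).
rewrite /codim krull_dim_setT //; lia.
Qed.
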